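(* Let $A$ be a set of preferences whose preference relation has a negatively transitive asymmetric part. Let $A$ be connected and have a countable dense subset $D$ with respect to the interval topology on $A$. Then there exists a continuous generalized utility function $u$ on $A$ which maps the set $A$ onto some interval $\Lambda\in U$ and its subset $D$ onto the intersection $\Lambda\cap\mathbb{Q}$, where $U$ is the set of the four intervals in $\mathbb{R}$ with endpoints $0$ and $1$.
   Context: A set of preferences is a non-empty set $A$ with a preference relation $R$, i.e. a reflexive and transitive binary relation, not necessarily complete. Its asymmetric part is $F=P_R=R\setminus(R\cap R^{-1})$. $F$ is negatively transitive if the complement of $F$ in $A^2$ is transitive, i.e. $xFz$ implies $xFy$ or $yFz$ for every $y\in A$. Open intervals in $A$ are the subsets $(x,y)=\{z\in A\mid xFz\text{ and }zFy\}$, $(\leftarrow,x)=\{z\in A\mid zFx\}$, $(x,\rightarrow)=\{z\in A\mid xFz\}$, with $x,y\in A$. The interval topology on $A$ is the topology generated by all open intervals (open sets are the unions of finite intersections of open intervals). Let $\mathcal{E}=E_F$ be the relation ''$x$ and $y$ are not $F$-comparable'' (neither $xFy$ nor $yFx$). A generalized utility function on $A$ is a function $u\colon A\to\mathbb{R}$ such that: (a) $u(x)<u(y)$ if and only if $xFy$; (b) $u(x)=u(y)$ if and only if $x\mathcal{E}y$. $U=\{(0,1),[0,1),(0,1],[0,1]\}$.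
   Formalization: Two hypotheses added, both necessary: some two elements satisfy xFy (false for a one-point A), and every F-minimal or F-maximal element of A is non-comparable to (or equals) an element of D (false for A=[0,1), D=Q∩(0,1)). *)

(* Defs.v *)
From HB Require Import structures.
From mathcomp Require Import all_boot all_order all_algebra.
From mathcomp Require Import all_classical all_reals all_analysis.

Set Implicit Arguments.
Unset Strict Implicit.
Unset Printing Implicit Defensive.

Import Order.TTheory GRing.Theory Num.Theory.
Import numFieldNormedType.Exports.

Local Open Scope classical_set_scope.
Local Open Scope ring_scope.

Section Preferences.
Context {A : Type}.
Implicit Types (R F : A -> A -> Prop) (x y z : A).

Definition preference R : Prop :=
  [/\ [set: A] !=set0,
      (forall x, R x x) &
      (forall x y z, R x y -> R y z -> R x z)].

Definition asym_part R : A -> A -> Prop := fun x y => R x y /\ ~ R y x.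

Definition negatively_transitive F : Prop :=
  forall x y z, ~ F x y -> ~ F y z -> ~ F x z.

Definition incomparable F : A -> A -> Prop := fun x y => ~ F x y /\ ~ F y x.

Definition open_interval F (I : set A) : Prop :=
  [\/ exists x y, I = [set z | F x z /\ F z y],
      exists x, I = [set z | F z x] |
      exists x, I = [set z | F x z]].

End Preferences.

(* An alias of A whose type records R, so that the interval topology of the
   preference relation R can be a canonical structure.  The orientation is that
   F x y reads "x is strictly below y", as u x < u y below requires. *)
Definition pref_space (A : Type) (R : A -> A -> Prop) : Type := A.

HB.instance Definition _ (A : Type) (R : A -> A -> Prop) :=
  gen_eqMixin (pref_space R).
HB.instance Definition _ (A : Type) (R : A -> A -> Prop) :=
  gen_choiceMixin (pref_space R).
(* The subbase is the family of all open intervals, indexed by itself; the empty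
   intersection contributes the whole space. *)
HB.instance Definition _ (A : Type) (R : A -> A -> Prop) :=
  @isSubBaseTopological.Build (pref_space R)
    (set (pref_space R)) (open_interval (asym_part R)) id.

Definition generalized_utility (K : realType) (A : Type) (F : A -> A -> Prop)
    (u : A -> K) : Prop :=
  forall x y, (u x < u y <-> F x y) /\ (u x = u y <-> incomparable F x y).

(* U: the four intervals of the real line with endpoints 0 and 1. *)
Definition unit_intervals (K : realType) : seq (interval K) :=
  [:: `]0, 1[; `[0, 1[; `]0, 1]; `[0, 1] ].

(* Every F-minimal and every F-maximal element of A (if there is one) is
   indifferent to some element of D.  A dense D can miss the extreme
   indifference classes, e.g. the rationals of ]0, 1[ inside [0, 1[; no u can
   then send D onto all rationals of the image of u, because 0 is one of them
   and is attained only at the least elements. *)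
Definition meets_extremes (A : Type) (F : A -> A -> Prop) (D : set A) : Prop :=
  (forall a, (forall x, ~ F x a) -> exists2 d, D d & incomparable F a d) /\
  (forall a, (forall x, ~ F a x) -> exists2 d, D d & incomparable F a d).

(* Main.v *)
(** Connectedness makes the order dense, so the points of [D] that are neither
    least nor greatest form a countable dense unbounded strict weak order.
    Cantor's back-and-forth argument labels them by the rationals of ]0, 1[.
    With [u x] the supremum of [0] and of the labels below [x], [u] agrees with
    the labelling and sends a least element to 0 and a greatest one to 1.  It is
    continuous because its values contain the rationals of ]0, 1[, and by
    connectedness its range is an interval. *)

Require Import Defs.
From HB Require Import structures.
From mathcomp Require Import all_boot all_order all_algebra.
From mathcomp Require Import all_classical all_reals all_analysis.
From mathcomp Require Import lra.
Import Order.TTheory GRing.Theory Num.Theory.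
Import numFieldNormedType.Exports.
Local Open Scope classical_set_scope.
Local Open Scope ring_scope.

Set Implicit Arguments.
Unset Strict Implicit.
Unset Printing Implicit Defensive.

(** * Strict weak orders *)

Section StrictWeakOrder.
Context {T : Type}.
Implicit Types (F : T -> T -> Prop).

(** Incomparability is then an equivalence and [F] orders its classes linearly. The development
    works with representatives instead of forming the quotient. *)
Definition strict_weak_order F : Prop :=
  [/\ forall x, ~ F x x,
      forall x y z, F x y -> F y z -> F x z &
      negatively_transitive F].

Definition dense_unbounded F : Prop :=
  [/\ forall x z, F x z -> exists y, F x y /\ F y z,
      forall x, exists y, F y x &
      forall x, exists y, F x y].

Lemma strict_weak_order_flip F :
  strict_weak_order F -> strict_weak_order (fun x y => F y x).
Proof.
case=> irr tr nt; split=> // [x y z yx zy|x y z nyx nzy].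
  exact: tr zy yx.
exact: nt nzy nyx.
Qed.

Lemma incomparable_sym F x y : incomparable F x y -> incomparable F y x.
Proof. by case. Qed.

Lemma incomparable_ltr F x y z : strict_weak_order F ->
  incomparable F x y -> F z x -> F z y.
Proof.
case=> _ _ nt [nxy nyx] zx; apply: contrapT => nzy.
exact: nt nzy nyx zx.
Qed.

Lemma incomparable_ltl F x y z : strict_weak_order F ->
  incomparable F x y -> F x z -> F y z.
Proof.
move=> /strict_weak_order_flip swo [nxy nyx].
exact: (incomparable_ltr (F := fun x y => F y x)).
Qed.

Lemma strict_weak_order_trichotomy F x y :
  [\/ F x y, incomparable F x y | F y x].
Proof.
have [xy|nxy] := pselect (F x y); first by constructor 1.
by have [yx|nyx] := pselect (F y x); [constructor 3|constructor 2].
Qed.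

End StrictWeakOrder.

(** * Cantor's back-and-forth argument *)

Lemma exists_maximal (T : eqType) (F : T -> T -> Prop) x0 (s : seq T) :
  strict_weak_order F ->
  exists2 m, m \in x0 :: s & forall x, x \in x0 :: s -> ~ F m x.
Proof.
move=> [irr tr nt]; elim: s x0 => [|x1 s IH] x0.
  by exists x0; rewrite ?inE// => x; rewrite inE => /eqP->.
have [m ms mmax] := IH x1; have [mx0|nmx0] := pselect (F m x0).
  exists x0; first by rewrite inE eqxx.
  move=> x; rewrite inE => /orP[/eqP->//|xs] x0x.
  exact: mmax xs (tr _ _ _ mx0 x0x).
exists m; first by rewrite inE ms orbT.
by move=> x; rewrite inE => /orP[/eqP->//|/mmax].
Qed.

(** Only a maximal element of [L] and a minimal element of [U] matter, since negative transitivity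
    carries bounds on them to the whole lists. Density is used when both lists are nonempty,
    unboundedness when one is empty, and [t0] when both are. *)
Lemma exists_between (T : eqType) (F : T -> T -> Prop) (t0 : T) (L U : seq T) :
  strict_weak_order F -> dense_unbounded F ->
  (forall l u, l \in L -> u \in U -> F l u) ->
  exists y, (forall l, l \in L -> F l y) /\ (forall u, u \in U -> F y u).
Proof.
move=> swo [dns nomin nomax] LU.
have lt_max m y l : ~ F m l -> F m y -> F l y.
  move=> nml my; apply: contrapT => nly.
  by case: swo => _ _ nt; exact: nt nml nly my.
have min_lt m y u : ~ F u m -> F y m -> F y u.
  move=> num ym; apply: contrapT => nyu.
  by case: swo => _ _ nt; exact: nt nyu num ym.
case: L U LU => [|l0 L] [|u0 U] LU.
- by exists t0.
- have [m mU mmin] := exists_maximal u0 U (strict_weak_order_flip swo).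
  have [y ym] := nomin m; exists y; split=> // u /mmin num.
  exact: min_lt num ym.
- have [m mL mmax] := exists_maximal l0 L swo.
  have [y my] := nomax m; exists y; split=> // l /mmax nml.
  exact: lt_max nml my.
- have [m mL mmax] := exists_maximal l0 L swo.
  have [n nU nmin] := exists_maximal u0 U (strict_weak_order_flip swo).
  have [y [my yn]] := dns _ _ (LU _ _ mL nU).
  exists y; split=> [l /mmax nml|u /nmin nun].
    exact: lt_max nml my.
  exact: min_lt nun yn.
Qed.

(** A finite relation rather than a function: a point may have several partners. When [F] is
    irreflexive these are [G]-incomparable. *)
Definition partial_iso (X Y : eqType) (F : X -> X -> Prop) (G : Y -> Y -> Prop)
    (s : seq (X * Y)) : Prop :=
  forall p q, p \in s -> q \in s -> (F p.1 q.1 <-> G p.2 q.2).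

Definition swap_pairs (X Y : Type) (s : seq (X * Y)) : seq (Y * X) :=
  [seq (p.2, p.1) | p <- s].

Lemma mem_swap_pairs (X Y : eqType) (s : seq (X * Y)) x y :
  ((y, x) \in swap_pairs s) = ((x, y) \in s).
Proof.
apply/mapP/idP => [[[a b] abs [-> ->]]//|xys]; by exists (x, y).
Qed.

Lemma partial_iso_swap (X Y : eqType) (F : X -> X -> Prop) (G : Y -> Y -> Prop)
    (s : seq (X * Y)) :
  partial_iso F G s -> partial_iso G F (swap_pairs s).
Proof.
move=> iso [y x] [y' x']; rewrite !mem_swap_pairs => xy xy'.
exact: iff_sym (iso _ _ xy xy').
Qed.

(** If [x] is incomparable to a listed point, it can take over the partner of that point. Otherwise
    every listed point lies strictly below or strictly above [x], and a partner is found between the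
    images of the two groups. *)
Lemma partial_iso_forth (X Y : eqType) (F : X -> X -> Prop)
    (G : Y -> Y -> Prop) (y0 : Y) (s : seq (X * Y)) (x : X) :
  strict_weak_order F -> strict_weak_order G -> dense_unbounded G ->
  partial_iso F G s -> exists y, partial_iso F G ((x, y) :: s).
Proof.
move=> swoF swoG denseG iso.
suff [y yP] : exists y, forall p, p \in s ->
    (F p.1 x <-> G p.2 y) /\ (F x p.1 <-> G y p.2).
  exists y => p q; rewrite !inE.
  have [[irrF _ _] [irrG _ _]] := (swoF, swoG).
  move=> /orP[/eqP->|ps] /orP[/eqP->|qs] /=.
  - by split=> [/irrF|/irrG].
  - by have [] := yP _ qs.
  - by have [] := yP _ ps.
  - exact: iso.
have [[[a b] abs xa]|nox] := pselect (exists2 p, p \in s & incomparable F x p.1).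
  exists b => p /[dup] ps /(iso _ _ abs) /= ap.
  have pa := iso _ _ ps abs; have ax := incomparable_sym xa; split.
    split=> [/(incomparable_ltr swoF xa)/pa//|/pa].
    exact: incomparable_ltr ax.
  split=> [/(incomparable_ltl swoF xa)/ap//|/ap].
  exact: incomparable_ltl ax.
have [irrG trG _] := swoG; have [_ trF _] := swoF.
pose L := [seq p.2 | p <- s & `[< F p.1 x >]].
pose U := [seq p.2 | p <- s & `[< F x p.1 >]].
have LU l u : l \in L -> u \in U -> G l u.
  move=> /mapP[p]; rewrite mem_filter => /andP[/asboolP px ps] ->.
  move=> /mapP[q]; rewrite mem_filter => /andP[/asboolP xq qs] ->.
  by apply/(iso _ _ ps qs); exact: trF px xq.
have [y [Ly yU]] := exists_between y0 swoG denseG LU.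
exists y => p ps.
have below : F p.1 x -> G p.2 y.
  move=> px; apply: Ly; apply/mapP; exists p => //.
  by rewrite mem_filter ps andbT; apply/asboolP.
have above : F x p.1 -> G y p.2.
  move=> xp; apply: yU; apply/mapP; exists p => //.
  by rewrite mem_filter ps andbT; apply/asboolP.
(* [below] and [above] are one-way implications; asymmetry on both sides upgrades them to
   equivalences. *)
have asymF a b : F a b -> ~ F b a.
  by have [irrF _ _] := swoF; move=> ab /(trF _ _ _ ab)/irrF.
have asymG a b : G a b -> ~ G b a by move=> ab /(trG _ _ _ ab)/irrG.
case: (strict_weak_order_trichotomy F p.1 x) => [px|px|xp].
- have py := below px; split; first by split.
  by split=> [/(asymF _ _ px)|/(asymG _ _ py)].
- by exfalso; apply: nox; exists p => //; exact: incomparable_sym px.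
- have yp := above xp; split; last by split.
  by split=> [/(asymF _ _ xp)|/(asymG _ _ yp)].
Qed.

(** The back step is the forth step applied to the swapped list; swapping again restores the
    orientation. *)
Lemma partial_iso_back_and_forth (X Y : eqType) (F : X -> X -> Prop)
    (G : Y -> Y -> Prop) (s : seq (X * Y)) (x : X) (y : Y) :
  strict_weak_order F -> dense_unbounded F ->
  strict_weak_order G -> dense_unbounded G ->
  partial_iso F G s ->
  exists s', [/\ partial_iso F G s', {subset s <= s'},
    exists y', (x, y') \in s' & exists x', (x', y) \in s'].
Proof.
move=> swoF denseF swoG denseG iso.
have [y' iso'] := partial_iso_forth y x swoF swoG denseG iso.
have [x' iso''] := partial_iso_forth x y swoG swoF denseF (partial_iso_swap iso').
exists ((x', y) :: (x, y') :: s); split.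
- have := partial_iso_swap iso''; rewrite /= /swap_pairs -map_comp.
  by under eq_map do [rewrite /= -surjective_pairing]; rewrite map_id.
- by move=> p ps; rewrite !inE ps !orbT.
- by exists y'; rewrite !inE eqxx orbT.
- by exists x'; rewrite inE eqxx.
Qed.

(** Surjectivity holds only up to incomparability: [y] is paired with some [x] at its stage, but
    [f x] may be another partner of that same [x]. *)
Lemma cantor_iso (X Y : eqType) (F : X -> X -> Prop) (G : Y -> Y -> Prop)
    (iX : X -> nat) (iY : Y -> nat) (x0 : X) (y0 : Y) :
  injective iX -> injective iY ->
  strict_weak_order F -> dense_unbounded F ->
  strict_weak_order G -> dense_unbounded G ->
  exists f : X -> Y, (forall x x', F x x' <-> G (f x) (f x')) /\
    (forall y, exists x, incomparable G (f x) y).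
Proof.
move=> injX injY swoF denseF swoG denseG.
(* The injections are turned into enumerations, with [x0] and [y0] as values at the codes that are
   not attained. *)
have /choice[enX enXP] : forall n, exists x, forall x', iX x' = n -> x' = x.
  move=> n; have [[x xn]|nox] := pselect (exists x, iX x = n).
    by exists x => x' x'n; apply: injX; rewrite xn.
  by exists x0 => x' x'n; exfalso; apply: nox; exists x'.
have /choice[enY enYP] : forall n, exists y, forall y', iY y' = n -> y' = y.
  move=> n; have [[y yn]|noy] := pselect (exists y, iY y = n).
    by exists y => y' y'n; apply: injY; rewrite yn.
  by exists y0 => y' y'n; exfalso; apply: noy; exists y'.
(* Stage [n] treats the [n]-th points of both sides. The step is made total by an arbitrary value on
   lists that are not partial isomorphisms; the stages [S n] never meet that case. *)
have /choice[step stepP] : forall ns : nat * seq (X * Y), exists s',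
    partial_iso F G ns.2 -> [/\ partial_iso F G s', {subset ns.2 <= s'},
      exists y', (enX ns.1, y') \in s' & exists x', (x', enY ns.1) \in s'].
  move=> [n s]; have [iso|niso] := pselect (partial_iso F G s); last by exists s.
  have [s' ?] := partial_iso_back_and_forth (enX n) (enY n) swoF denseF swoG
    denseG iso.
  by exists s'.
pose S := fix S n := if n is m.+1 then step (m, S m) else [::].
have isoS n : partial_iso F G (S n).
  by elim: n => [|n IH] //=; have [] := stepP (n, S n) IH.
have monoS m n : (m <= n)%N -> {subset S m <= S n}.
  move=> /subnKC <-; elim: (n - m)%N => [|k IH]; first by rewrite addn0.
  by rewrite addnS => p /IH; have [_ + _ _] := stepP (m + k, S (m + k))%N (isoS _); exact.
have isoU n m p q : p \in S n -> q \in S m -> (F p.1 q.1 <-> G p.2 q.2).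
  move=> /(monoS _ _ (leq_maxl n m)) pS /(monoS _ _ (leq_maxr n m)) qS.
  exact: isoS pS qS.
have /choice[f fP] : forall x, exists y, exists n, (x, y) \in S n.
  move=> x; have [_ _ [y xy] _] := stepP (iX x, S (iX x)) (isoS _).
  by rewrite /= -(enXP _ x erefl) in xy; exists y, (iX x).+1.
exists f; split=> [x x'|y].
  by have [[n xn] [m x'm]] := (fP x, fP x'); exact: isoU xn x'm.
have [_ _ _ [x xy]] := stepP (iY y, S (iY y)) (isoS _); exists x.
rewrite /= -(enYP _ y erefl) in xy; have [irrF _ _] := swoF.
have {}xy : (x, y) \in S (iY y).+1 by [].
have [n xn] := fP x.
by split; [move=> /(isoU _ _ _ _ xn xy)/irrF|move=> /(isoU _ _ _ _ xy xn)/irrF].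
Qed.

(** * Labelling by the rationals of ]0, 1[ *)

Definition nonextreme_points (T : Type) (F : T -> T -> Prop) (D : set T) : set T :=
  [set d | [/\ D d, exists x, F x d & exists x, F d x]].

(** The second clause forces incomparable points of [I] to share a label. Values of [g] outside [I]
    are unconstrained. *)
Definition rational_labelling (K : realType) (T : Type) (F : T -> T -> Prop)
    (I : set T) (g : T -> K) : Prop :=
  [/\ forall d, I d -> exists2 q : rat, 0 < q < 1 & g d = ratr q,
      forall d e, I d -> I e -> (F d e <-> g d < g e) &
      forall q : rat, 0 < q < 1 -> exists2 d, I d & g d = ratr q].

Lemma exists_rational_labelling (K : realType) (T : choiceType)
    (F : T -> T -> Prop) (I : set T) :
  countable I -> I !=set0 -> strict_weak_order F ->
  (forall x z, I x -> I z -> F x z -> exists2 y, I y & F x y /\ F y z) ->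
  (forall x, I x -> exists2 y, I y & F y x) ->
  (forall x, I x -> exists2 y, I y & F x y) ->
  exists g : T -> K, rational_labelling F I g.
Proof.
move=> /countable_injP[i inji] [d0 Id0] [irr tr nt] dns nomin nomax.
pose Q := [set q : rat | 0 < q < 1].
have half : Q (2^-1 : rat) by [].
pose FI (x y : I) := F (val x) (val y).
pose GQ (p q : Q) := val p < val q.
pose toI d (h : I d) : I := SigSub (mem_set h).
pose toQ q (h : Q q) : Q := SigSub (mem_set h).
have iI (x : I) : I (val x) by exact: set_mem (valP x).
have iQ (q : Q) : 0 < val q < 1 by exact: set_mem (valP q).
have swoFI : strict_weak_order FI.
  split=> [x|x y z|x y z]; [exact: irr|exact: tr|exact: nt].
have swoGQ : strict_weak_order GQ.
  split=> [x|x y z|x y z]; rewrite /GQ; first by rewrite ltxx.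
    exact: lt_trans.
  by move=> /negP; rewrite -leNgt => yx /negP; rewrite -leNgt => /le_trans/(_ yx);
    rewrite leNgt => /negP.
have denseFI : dense_unbounded FI.
  split=> [x z /(dns _ _ (iI x) (iI z))[y Iy [xy yz]]|x|x].
  - by exists (toI y Iy).
  - by have [y Iy yx] := nomin _ (iI x); exists (toI y Iy).
  - by have [y Iy yx] := nomax _ (iI x); exists (toI y Iy).
have denseGQ : dense_unbounded GQ.
  have mid (p q : rat) : 0 <= p -> q <= 1 -> p < q ->
      exists2 r : Q, p < val r & val r < q.
    move=> p0 q1 pq; have [pm mq] := midf_lt pq.
    have m01 : Q ((p + q) / 2).
      by rewrite /Q /= (le_lt_trans p0 pm) (lt_le_trans mq q1).
    by exists (toQ _ m01).
  split=> [x z xz|x|x].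
  - have /andP[x0 _] := iQ x; have /andP[_ z1] := iQ z.
    by have [r] := mid _ _ (ltW x0) (ltW z1) xz; exists r.
  - have /andP[x0 x1] := iQ x.
    by have [r] := mid _ _ (lexx 0) (ltW x1) x0; exists r.
  - have /andP[x0 x1] := iQ x.
    by have [r] := mid _ _ (ltW x0) (lexx 1) x1; exists r.
have injiI : injective (fun x : I => i (val x)).
  by move=> x y /inji xy; apply: val_inj; apply: xy; exact: mem_set.
have injiQ : injective (fun q : Q => pickle (val q)).
  by move=> p q /(pcan_inj pickleK) /val_inj.
have [f [fF fsurj]] := cantor_iso (toI _ Id0) (toQ _ half) injiI injiQ
  swoFI denseFI swoGQ denseGQ.
(* The value 0 off [I] is a mere default. On [I] the label does not depend on the membership proof,
   as [gE] records. *)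
pose g d : K := if pselect (I d) is left h then ratr (val (f (toI d h))) else 0.
have gE d (h : I d) : g d = ratr (val (f (toI d h))).
  rewrite /g; case: pselect => // h'; congr (ratr (val (f _))).
  exact: val_inj.
exists g; split.
- by move=> d Id; exists (val (f (toI d Id))); [exact: iQ|exact: gE].
- move=> d e Id Ie; rewrite !gE ltr_rat.
  exact: (fF (toI d Id) (toI e Ie)).
- move=> q q01; have [x [nxq nqx]] := fsurj (toQ q q01).
  exists (val x); first exact: iI.
  rewrite gE; congr ratr.
  have -> : toI (val x) (iI x) = x by exact: val_inj.
  (* In the linear order of the rationals, incomparable means equal, so surjectivity becomes
     exact. *)
  by apply/eqP; rewrite eq_le !leNgt; apply/andP; split; apply/negP.
Qed.

(** * The interval topology and connectedness *)

Section IntervalTopology.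
Context {A : Type} {R : A -> A -> Prop}.
Local Notation F := (asym_part R).
Local Notation T := (pref_space R).

Lemma asym_part_strict_weak_order :
  preference R -> negatively_transitive F -> strict_weak_order F.
Proof.
move=> [_ _ tr] nt; split=> // [x [xx]//|x y z [xy nyx] [yz nzy]].
by split; [exact: tr xy yz|move=> zx; apply: nyx; exact: tr yz zx].
Qed.

Lemma open_open_interval (I : set T) : open_interval F I -> open I.
Proof.
move=> intI; exists [set I]; last by rewrite bigcup_set1.
by move=> _ ->; exact: finI_from1.
Qed.

Lemma open_below (x : T) : open [set z : T | F z x].
Proof. by apply: open_open_interval; constructor 2; exists x. Qed.

Lemma open_above (x : T) : open [set z : T | F x z].
Proof. by apply: open_open_interval; constructor 3; exists x. Qed.

Lemma open_between (x y : T) : open [set z : T | F x z /\ F z y].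
Proof. by apply: open_open_interval; constructor 1; exists x, y. Qed.

Hypothesis swoF : strict_weak_order F.
Hypothesis connT : connected [set: T].

(* If nothing lies between x and y, the rays below y and above x are disjoint
   and cover the space. *)
Lemma connected_between (x y : T) : F x y -> exists z : T, F x z /\ F z y.
Proof.
have [irr tr nt] := swoF => xy; apply: contrapT => nz.
have : [set z : T | F z y] = [set: T].
  apply: connT; first by exists x.
    by exists [set z : T | F z y]; [exact: open_below|rewrite setTI].
  exists (~` [set z : T | F x z]); first exact/open_closedC/open_above.
  rewrite setTI; apply/seteqP; split=> z /=.
    by move=> zy xz; apply: nz; exists z.
  by move=> nxz; apply: contrapT => nzy; exact: nt nxz nzy xy.
by move/seteqP => [_ /(_ y I)]; exact: irr.
Qed.

(** The open interval from [x] to [y] is nonempty by connectedness, so it meets [D]; the point found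
    is not extreme because [x] lies below it and [y] above. *)
Lemma dense_between (D : set T) (x y : T) : dense D -> F x y ->
  exists2 d, nonextreme_points F D d & F x d /\ F d y.
Proof.
move=> denseD xy.
have [d [[xd dy] Dd]] : [set z : T | F x z /\ F z y] `&` D !=set0.
  apply: denseD; last exact: open_between.
  by have [z zP] := connected_between xy; exists z.
by exists d => //; split; [|exists x|exists y].
Qed.

End IntervalTopology.

(** * The utility as a supremum of labels *)

Section Utility.
Context {K : realType} {A : Type} {R : A -> A -> Prop}.
Local Notation F := (asym_part R).
Local Notation T := (pref_space R).
Variables (D : set T) (g : T -> K).
Local Notation I := (nonextreme_points F D).
Hypothesis swoF : strict_weak_order F.
Hypothesis connT : connected [set: T].
Hypothesis denseD : dense D.
Hypothesis labg : rational_labelling F I g.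

(* Adding 0 gives the supremum its intended value when no label lies below. *)
Definition cut_values (x : T) : set K :=
  [set 0] `|` g @` [set d | I d /\ F d x].

Definition cut_utility (x : T) : K := sup (cut_values x).
Local Notation u := cut_utility.

Lemma label_itv d : I d -> 0 < g d < 1.
Proof.
have [gI _ _] := labg => /gI[q q01 ->].
by rewrite -[1%R](rmorph1 (@ratr K)) ltr0q ltr_rat.
Qed.

(** The labels exhaust the rationals of ]0, 1[ and are therefore dense in [0, 1]. *)
Lemma label_between (a b : K) : 0 <= a -> b <= 1 -> a < b ->
  exists2 d, I d & a < g d < b.
Proof.
move=> a0 b1 /rat_in_itvoo[q]; rewrite in_itv/= => /andP[aq qb].
have [_ _ gsurj] := labg; have [|d Id gd] := gsurj q.
  by rewrite -(ltr0q K) -(ltr_rat K q) rmorph1 (le_lt_trans a0 aq) (lt_le_trans qb b1).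
by exists d; rewrite // gd aq qb.
Qed.

Lemma cut_values_ub1 x : ubound (cut_values x) 1.
Proof. by move=> _ [->//|[d [/label_itv/andP[_ /ltW]]]] + _ <-. Qed.

Lemma cut_utility_ub x t : cut_values x t -> t <= u x.
Proof. by apply: ub_le_sup; exists 1; exact: cut_values_ub1. Qed.

Lemma cut_utility_le x t : ubound (cut_values x) t -> u x <= t.
Proof. by apply: ge_sup; exists 0; left. Qed.

Lemma cut_utility_ge0 x : 0 <= u x.
Proof. by apply: cut_utility_ub; left. Qed.

Lemma cut_utility_le1 x : u x <= 1.
Proof. exact/cut_utility_le/cut_values_ub1. Qed.

Lemma label_le_cut_utility d x : I d -> F d x -> g d <= u x.
Proof. by move=> Id dx; apply: cut_utility_ub; right; exists d. Qed.

(** If some [e] below [x] had a label exceeding [g d], then [d] would lie below [e] and hence below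
    [x]. The adjoined 0 is harmless because labels are positive. *)
Lemma cut_utility_le_label d x : I d -> ~ F d x -> u x <= g d.
Proof.
have [_ gmono _] := labg; have [_ tr nt] := swoF.
move=> Id ndx; apply: cut_utility_le => _ [->|[e [Ie ex]] <-].
  by have /andP[/ltW] := label_itv Id.
by rewrite leNgt; apply/negP => /(gmono _ _ Id Ie) de; apply: ndx; exact: tr de ex.
Qed.

(** If [u d] were smaller than [g d], a label strictly between them would belong to a point below
    [d] and so be at most [u d]. *)
Lemma cut_utility_label d : I d -> u d = g d.
Proof.
have [_ gmono _] := labg; have [irr _ _] := swoF.
move=> Id; apply/eqP; rewrite eq_le cut_utility_le_label//= leNgt.
apply/negP => ud; have /andP[_ gd1] := label_itv Id.
have [e Ie /andP[ue eg]] := label_between (cut_utility_ge0 d) (ltW gd1) ud.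
have /(label_le_cut_utility Ie) : F e d by exact/(gmono _ _ Ie Id).
by rewrite leNgt ue.
Qed.

(** One point of [D] between [x] and [y] would give only a weak inequality; two successive ones have
    distinct labels, which separate the suprema. *)
Lemma cut_utility_lt x y : F x y -> u x < u y.
Proof.
have [_ gmono _] := labg; have [irr tr _] := swoF.
move=> /(dense_between swoF connT denseD)[d Id [xd]].
move=> /(dense_between swoF connT denseD)[e Ie [de ey]].
apply: (@le_lt_trans _ _ (g d)).
  by apply: cut_utility_le_label => // dx; exact: irr (tr _ _ _ xd dx).
apply: (@lt_le_trans _ _ (g e)); first exact/(gmono _ _ Id Ie).
exact: label_le_cut_utility.
Qed.

Lemma cut_utility_incomparable x y : incomparable F x y -> u x = u y.
Proof.
move=> xy; congr (sup (_ `|` g @` _)); apply/seteqP; split=> d [Id].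
  by move=> /(incomparable_ltr swoF xy).
by move=> /(incomparable_ltr swoF (incomparable_sym xy)).
Qed.

Lemma cut_utility_generalized : generalized_utility F u.
Proof.
have [irr tr _] := swoF.
move=> x y; case: (strict_weak_order_trichotomy F x y) => [xy|xy|yx].
- have uxy := cut_utility_lt xy; split; first by split.
  by split=> [eq|[]//]; rewrite eq ltxx in uxy.
- have uxy := cut_utility_incomparable xy; split; last by split.
  by rewrite uxy ltxx; split=> // /(proj1 xy).
- have uyx := cut_utility_lt yx; split.
    split=> [|xy]; first by move=> /(lt_trans uyx); rewrite ltxx.
    by have := irr _ (tr _ _ _ xy yx).
  by split=> [eq|[_ nyx]//]; rewrite eq ltxx in uyx.
Qed.

Lemma cut_utility_min x : (forall y, ~ F y x) -> u x = 0.
Proof.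
move=> minx; apply/eqP; rewrite eq_le cut_utility_ge0 andbT.
by apply: cut_utility_le => _ [->//|[d [_ dx] <-]]; case: (minx d).
Qed.

(** A label strictly between [u x] and 1 would belong to a point with something above it. As nothing
    is above [x], negative transitivity puts that point below [x], so its label is at most [u x]. *)
Lemma cut_utility_max x : (forall y, ~ F x y) -> u x = 1.
Proof.
have [_ _ nt] := swoF.
move=> maxx; apply/eqP; rewrite eq_le cut_utility_le1/= leNgt.
apply/negP => /(label_between (cut_utility_ge0 x) (lexx 1))[d Id].
move=> /andP[ud _]; have [_ _ [y dy]] := Id.
have dx : F d x by apply: contrapT => ndx; exact: nt ndx (maxx y) dy.
by have := label_le_cut_utility Id dx; rewrite leNgt ud.
Qed.

Lemma cut_utility_gt0 x : 0 < u x <-> exists y, F y x.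
Proof.
split=> [ux|[y /cut_utility_lt]]; last exact/le_lt_trans/cut_utility_ge0.
apply: contrapT => /forallNP /cut_utility_min ux0.
by rewrite ux0 ltxx in ux.
Qed.

Lemma cut_utility_lt1 x : u x < 1 <-> exists y, F x y.
Proof.
split=> [ux|[y /cut_utility_lt]]; last first.
  by move=> /lt_le_trans; apply; exact: cut_utility_le1.
apply: contrapT => /forallNP /cut_utility_max ux1.
by rewrite ux1 ltxx in ux.
Qed.

(** A label strictly between [u x - e] and [u x] belongs to some [d] whose upper ray is an open
    neighbourhood of [x] on which [u] exceeds [u x - e]. The upper estimate is symmetric. *)
Lemma continuous_cut_utility : continuous u.
Proof.
have [_ _ nt] := swoF.
move=> x; have filterx : Filter (nbhs x) := nbhs_filter x.
apply/cvgrPdist_lt => e e0.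
have lo : nbhs x [set y | u x - e < u y].
  (* A bound outside [0, 1] needs no neighbourhood argument, since [u] takes its values in
     [0, 1]. *)
  have [a0|a0] := ltP (u x - e) 0.
    by apply: filterE => y /=; rewrite (lt_le_trans a0 (cut_utility_ge0 y)).
  have [d Id /andP[ad dx]] :=
    label_between a0 (cut_utility_le1 x) (ltac:(lra) : u x - e < u x).
  apply: (filterS (P := [set y | F d y])).
    by move=> y /= /cut_utility_lt; rewrite (cut_utility_label Id); exact: lt_trans.
  apply: open_nbhs_nbhs; split; first exact: open_above.
  apply: contrapT => /(cut_utility_le_label Id).
  by rewrite leNgt dx.
have hi : nbhs x [set y | u y < u x + e].
  have [a1|a1] := ltP 1 (u x + e).
    by apply: filterE => y /=; rewrite (le_lt_trans (cut_utility_le1 y) a1).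
  have [d Id /andP[xd da]] :=
    label_between (cut_utility_ge0 x) a1 (ltac:(lra) : u x < u x + e).
  apply: (filterS (P := [set y | F y d])).
    move=> y /= /cut_utility_lt; rewrite (cut_utility_label Id) => yd.
    exact: lt_trans yd da.
  apply: open_nbhs_nbhs; split; first exact: open_below.
  by apply/(cut_utility_generalized x d).1; rewrite (cut_utility_label Id).
apply: filterS2 lo hi => y /= lo hi.
by rewrite ltr_distlC; apply/andP; split; lra.
Qed.

(** * The images of the space and of [D] *)

Definition has_least : Prop := exists x : T, forall y, ~ F y x.
Definition has_greatest : Prop := exists x : T, forall y, ~ F x y.

(* The first boolean of a BSide is true for a closed left endpoint, the second
   one false for a closed right endpoint. *)
Definition range_interval : interval K :=
  Interval (BSide `[< has_least >] 0) (BSide (~~ `[< has_greatest >]) 1).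

Lemma range_interval_unit : range_interval \in unit_intervals K.
Proof.
by rewrite /range_interval; case: `[< _ >]; case: `[< _ >];
  rewrite /= !inE eqxx ?orbT.
Qed.

(** Separating the interior from the endpoints lets the image computations treat the four intervals
    at once. *)
Lemma mem_range_interval t : [set` range_interval] t <->
  [\/ 0 < t < 1, t = 0 /\ has_least | t = 1 /\ has_greatest].
Proof.
rewrite /range_interval /= in_itv/= negbK.
case: (asboolP has_least) => hl; case: (asboolP has_greatest) => hg /=;
  split; try by case=> [|[-> ?]|[-> ?]] //; rewrite ?ltr01 ?ler01 ?lexx//
    => /andP[? ?]; rewrite ?ltW//; apply/andP.
- rewrite !le_eqVlt => /andP[/orP[/eqP<- _|t0 /orP[/eqP->|t1]]].
  + by constructor 2.
  + by constructor 3.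
  + by constructor 1; rewrite t0.
- rewrite le_eqVlt => /andP[/orP[/eqP<- _|t0 t1]]; first by constructor 2.
  by constructor 1; rewrite t0.
- rewrite [_ <= 1]le_eqVlt => /andP[t0 /orP[/eqP->|t1]]; first by constructor 3.
  by constructor 1; rewrite t0.
- by constructor 1.
Qed.

Lemma cut_utility_least x : u x = 0 -> forall y, ~ F y x.
Proof.
move=> ux0 y yx; have /cut_utility_gt0 : exists y, F y x by exists y.
by rewrite ux0 ltxx.
Qed.

Lemma cut_utility_greatest x : u x = 1 -> forall y, ~ F x y.
Proof.
move=> ux1 y xy; have /cut_utility_lt1 : exists y, F x y by exists y.
by rewrite ux1 ltxx.
Qed.

Lemma cut_utility_trichotomy x :
  [\/ 0 < u x < 1, u x = 0 /\ forall y, ~ F y x | u x = 1 /\ forall y, ~ F x y].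
Proof.
have := cut_utility_le1 x; have := cut_utility_ge0 x.
rewrite !le_eqVlt => /orP[/eqP ux0 _|ux0 /orP[/eqP ux1|ux1]].
- by constructor 2; split=> //; exact: cut_utility_least.
- by constructor 3; split=> //; exact: cut_utility_greatest.
- by constructor 1; rewrite ux0.
Qed.

Lemma range_cut_utility : u @` [set: T] = [set` range_interval].
Proof.
apply/seteqP; split=> [_ [x _ <-]|t]; rewrite mem_range_interval.
  case: (cut_utility_trichotomy x) => [u01|[u0 minx]|[u1 maxx]].
  - by constructor 1.
  - by constructor 2; split=> //; exists x.
  - by constructor 3; split=> //; exists x.
case=> [/andP[t0 t1]|[-> [x minx]]|[-> [x maxx]]].
- have [d Id /andP[_ dt]] := label_between (lexx 0) (ltW t1) t0.
  have [e Ie /andP[te _]] := label_between (ltW t0) (lexx 1) t1.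
  (* The image is connected, hence an interval, and it contains the labels [g d] and [g e] on either
     side of [t]. *)
  have /connected_intervalP uT : connected (u @` [set: T]).
    apply: connected_continuous_connected connT _.
    exact/continuous_subspaceT/continuous_cut_utility.
  apply: (uT (g d) (g e)); last by rewrite !ltW.
    by exists d; rewrite // cut_utility_label.
  by exists e; rewrite // cut_utility_label.
- by exists x; rewrite // cut_utility_min.
- by exists x; rewrite // cut_utility_max.
Qed.

(** A point of [D] with value strictly inside ]0, 1[ is not extreme, so its value is its rational
    label, and all rationals there are labels. [meets_extremes] supplies points of [D] with value 0
    or 1 when these endpoints are attained. *)
Lemma image_cut_utility : meets_extremes F D ->
  u @` D = [set` range_interval] `&` range (@ratr K).
Proof.
have [gI _ gsurj] := labg.
move=> [minD maxD]; apply/seteqP; split=> [_ [d Dd <-]|t [tL [q _ qt]]].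
  split; first by rewrite -range_cut_utility; exists d.
  case: (cut_utility_trichotomy d) => [/andP[u0 u1]|[-> _]|[-> _]].
  - have Id : I d by split=> //; [exact/cut_utility_gt0|exact/cut_utility_lt1].
    by have [q _ gd] := gI _ Id; exists q; rewrite // cut_utility_label.
  - by exists 0; rewrite // rmorph0.
  - by exists 1; rewrite // rmorph1.
move: tL; rewrite -qt mem_range_interval => -[q01|[q0 [x minx]]|[q1 [x maxx]]].
- have [|d Id gd] := gsurj q.
    by rewrite -(ltr0q K) -(ltr_rat K q) rmorph1.
  by exists d; [case: Id|rewrite (cut_utility_label Id)].
- have [d Dd xd] := minD x minx; exists d => //.
  by rewrite q0 -(cut_utility_incomparable xd) cut_utility_min.
- have [d Dd xd] := maxD x maxx; exists d => //.
  by rewrite q1 -(cut_utility_incomparable xd) cut_utility_max.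
Qed.

End Utility.

Theorem theorem2p3p2 (K : realType) (A : Type) (R : A -> A -> Prop)
    (D : set (pref_space R))
    (prefR : preference R)
    (negtransR : negatively_transitive (asym_part R))
    (connA : connected [set: pref_space R])
    (countD : countable D)
    (denseD : dense D)
    (nontrivR : exists x y, asym_part R x y)
    (extrD : meets_extremes (asym_part R) D) :
  exists (u : pref_space R -> K) (Lambda : interval K),
    [/\ continuous u,
        generalized_utility (asym_part R) u,
        Lambda \in unit_intervals K,
        u @` [set: pref_space R] = [set` Lambda] &
        u @` D = [set` Lambda] `&` range (@ratr K)].
Proof.
have swoF := asym_part_strict_weak_order prefR negtransR.
have between := dense_between swoF connA denseD.
pose I := nonextreme_points (asym_part R) D.
have [g labg] : exists g : pref_space R -> K,
    rational_labelling (asym_part R) I g.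
  apply: exists_rational_labelling => //.
  - by apply: sub_countable countD; apply: subset_card_le => d [].
  (* Without a strictly ordered pair every generalized utility would be constant, and its range
     could not be one of the four intervals. *)
  - by have [x [y /between[d Id _]]] := nontrivR; exists d.
  - by move=> x z _ _ /between.
  (* A point that is not extreme has some [y] below it, and [between] puts another point of [I] in
     the gap; the last goal is dual. *)
  - by move=> x [_ [y /between[d Id [_ dx]]] _]; exists d.
  - by move=> x [_ _ [y /between[d Id [xd _]]]]; exists d.
exists (cut_utility D g), (range_interval (K := K) (R := R)); split.
- exact: continuous_cut_utility.
- exact: cut_utility_generalized.
- exact: range_interval_unit.
- exact: range_cut_utility.
- exact: image_cut_utility.
Qed.
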